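(* Let $G$ be a finite simple graph and let $\mathcal R'=\{\langle x\rangle' : x\in V(G')\}$ be a partial representation of $G$. Then $\mathcal R'$ is extendible if and only if for every set $A\subseteq V(G')$ with $|A|\le 4$, the partial representation $\mathcal R'[A]=\{\langle x\rangle' : x\in A\}$ of $G$ is extendible.
   Context: An interval representation of a graph $G$ assigns to each $x\in V(G)$ a closed interval $\langle x\rangle$ of the real line (single points allowed) so that for $x\ne y$, $\langle x\rangle\cap\langle y\rangle\neq\emptyset$ iff $xy\in E(G)$. A partial representation $\mathcal R'$ of $G$ is an interval representation $\{\langle x\rangle':x\in V(G')\}$ of an induced subgraph $G'$ of $G$ (possibly empty). It is extendible if $G$ has an interval representation $\mathcal R$ with $\langle x\rangle=\langle x\rangle'$ for all $x\in V(G')$. *)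

(* Defs.v *)
From mathcomp Require Import all_boot all_order all_algebra.
From mathcomp Require Import all_classical reals.

Set Implicit Arguments.
Unset Strict Implicit.
Unset Printing Implicit Defensive.

Import Order.TTheory GRing.Theory Num.Theory.
Local Open Scope classical_set_scope.
Local Open Scope ring_scope.

Record sgraph := SGraph {
  vertex :> finType;
  adj : rel vertex;
  adj_sym : symmetric adj;
  adj_irrefl : irreflexive adj }.

Section Induced.
Variables (G : sgraph) (W : {set G}).

Definition induced_adj : rel {x : G | x \in W} :=
  fun x y => adj (val x) (val y).

Lemma induced_adj_sym : symmetric induced_adj.
Proof. by move=> x y; rewrite /induced_adj adj_sym. Qed.

Lemma induced_adj_irrefl : irreflexive induced_adj.
Proof. by move=> x; rewrite /induced_adj adj_irrefl. Qed.

Definition induced : sgraph := SGraph induced_adj_sym induced_adj_irrefl.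

End Induced.

Section Representations.
Variable R : realType.

(* Bounded and nonempty; a = b gives a single point. *)
Definition closed_interval (S : set R) : Prop :=
  exists a b : R, a <= b /\ S = [set` `[a, b]].

Definition interval_rep (G : sgraph) (I : G -> set R) : Prop :=
  (forall x, closed_interval (I x)) /\
  (forall x y, x <> y -> (I x `&` I y !=set0 <-> adj x y)).

(* A family indexed by W is encoded by a total map I, whose values outside W
   are never consulted; its restriction to a subset A of W is then given by
   the pair (A, I). *)
Definition partial_rep (G : sgraph) (W : {set G}) (I : G -> set R) : Prop :=
  @interval_rep (induced W) (fun x => I (val x)).

Definition extendible (G : sgraph) (W : {set G}) (I : G -> set R) : Prop :=
  exists J : G -> set R,
    interval_rep J /\ (forall x, x \in W -> J x = I x).

Lemma partial_rep_sub (G : sgraph) (W A : {set G}) (I : G -> set R) :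
  A \subset W -> partial_rep W I -> partial_rep A I.
Proof.
move=> /fintype.subsetP AW [cI aI]; split=> [[x xA]|[x xA] [y yA] xy].
  exact: (cI (exist _ x (AW x xA))).
apply: (aI (exist _ x (AW x xA)) (exist _ y (AW y yA))) => -[exy].
by apply: xy; apply: val_inj.
Qed.

End Representations.

(* Main.v *)
(** An interval representation orders non-adjacent vertices from left to right:
    it gives a transitive orientation P of the complement H of G.  Writing
    closed neighbourhoods N[v], a predrawn x in N[z] bounds the right endpoint
    of z from below (by its own left endpoint, or by its right one if x = z),
    and dually for left endpoints; let D z and U w be the best such bounds on
    the right endpoint of z and the left endpoint of w.  Eliminating the
    unknown endpoints one vertex at a time shows that P is realized by an
    extension iff D z < U w whenever z is left of w.  So every pair with
    U a <= D b forces a to be left of b, and each such requirement is witnessed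
    by two predrawn vertices: any two requirements are compatible by the
    hypothesis on quadruples.  It remains to satisfy all of them at once.
    Requirements inside one implication class of H agree, so only triangles of
    H meeting three classes could become cyclic.  Gallai's triangle lemma shows
    that these classes are X x Y, Y x Z, X x Z for fixed sets X, Y, Z, and
    ordering such sets S by (min of U on S) + (max of D on S) is acyclic and
    respects every requirement. *)
Require Import Defs.
From mathcomp Require Import all_boot all_order all_algebra.
From mathcomp Require Import all_classical reals.
From mathcomp Require Import lra.

Set Implicit Arguments.
Unset Strict Implicit.
Unset Printing Implicit Defensive.

Import Order.TTheory GRing.Theory Num.Theory.
Local Open Scope ring_scope.

(** * Implication classes and Gallai's triangle lemma *)

Definition transitive_orientation (T : finType) (H P : rel T) :=
  transitive P /\ forall x y, H x y = P x y || P y x.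

Section ImplicationClasses.
Variables (T : finType) (H : rel T).
Hypotheses (Hsym : symmetric H) (Hirr : irreflexive H).

(* Two edges of H that share an end, and whose other ends are not joined in H,
   point both to it or both away from it in every transitive orientation. *)
Definition forces : rel (T * T) := fun p q =>
  [&& H p.1 p.2, H q.1 q.2 &
      (p.1 == q.1) && ~~ H p.2 q.2 || (p.2 == q.2) && ~~ H p.1 q.1].

Definition iclass := connect forces.

(** On an edge of a rainbow triangle, [sources x y] and [sources y x] turn out to be the two factors
    of a product that is the whole class. *)
Definition sources (x y : T) : {set T} :=
  [set a | [exists b, iclass (x, y) (a, b)]].

Definition same_color (p q : T * T) := iclass p q || iclass p (q.2, q.1).

Definition rainbow (x y z : T) :=
  [/\ [/\ H x y, H y z & H x z], ~~ same_color (x, y) (y, z),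
      ~~ same_color (y, z) (x, z) & ~~ same_color (x, y) (x, z)].

Lemma forces_sym : symmetric forces.
Proof.
move=> [a b] [c d]; rewrite /forces /= (eq_sym a) (eq_sym b) (Hsym b) (Hsym a c).
by rewrite andbCA.
Qed.

Lemma iclass_sym : symmetric iclass.
Proof. exact/sym_connect_sym/forces_sym. Qed.

Lemma iclass_trans p q r : iclass p q -> iclass q r -> iclass p r.
Proof. exact: connect_trans. Qed.

Lemma iclass_ind (Q : T -> T -> Prop) (a b c d : T) :
    (forall x y z, H x y -> H x z -> ~~ H y z -> Q x y -> Q x z) ->
    (forall x y z, H x y -> H z y -> ~~ H x z -> Q x y -> Q z y) ->
  iclass (a, b) (c, d) -> Q a b -> Q c d.
Proof.
move=> Qr Ql /connectP[s]; elim: s a b => [|[e f] s IHs] a b /=.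
  by move=> _ [-> ->].
case/andP=> /and3P[/= Hab Hef /orP[]] /andP[/eqP E nH] sP sE Qab.
  by rewrite -E in Hef sP sE *; apply: (IHs a f) => //; apply: Qr Qab.
by rewrite -E in Hef sP sE *; apply: (IHs e b) => //; apply: Ql Qab.
Qed.

Lemma iclass_edge a b c d : iclass (a, b) (c, d) -> H a b -> H c d.
Proof. exact: (@iclass_ind (fun c d => H c d)). Qed.

Lemma iclass_forcer a b d : H a b -> H a d -> ~~ H b d -> iclass (a, b) (a, d).
Proof.
by move=> Hab Had Hbd; apply: connect1; rewrite /forces /= Hab Had eqxx Hbd.
Qed.

Lemma iclass_forcel a b c : H a b -> H c b -> ~~ H a c -> iclass (a, b) (c, b).
Proof.
by move=> Hab Hcb Hac; apply: connect1; rewrite /forces /= Hab Hcb eqxx Hac orbT.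
Qed.

Lemma iclass_rev a b c d : iclass (a, b) (c, d) -> iclass (b, a) (d, c).
Proof.
move=> abcd.
apply: (@iclass_ind (fun c d => iclass (b, a) (d, c)) a b c d) => //.
- move=> x y z Hxy Hxz Hyz /iclass_trans; apply.
  by apply: iclass_forcel => //; rewrite Hsym.
- move=> x y z Hxy Hzy Hxz /iclass_trans; apply.
  by apply: iclass_forcer => //; rewrite Hsym.
- exact: connect0.
Qed.

Lemma iclass_orient P a b c d : transitive_orientation H P ->
  iclass (a, b) (c, d) -> P a b -> P c d.
Proof.
move=> [Ptr HP]; apply: (@iclass_ind (fun c d => P c d)) => x y z _ Hxz nH Pxy.
  move: Hxz; rewrite HP => /orP[//|Pzx].
  by move: nH; rewrite HP (Ptr _ _ _ Pzx Pxy) orbT.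
move: Hxz; rewrite HP => /orP[//|Pyz].
by move: nH; rewrite HP (Ptr _ _ _ Pxy Pyz).
Qed.

Lemma orient_asym P x y : transitive_orientation H P -> P x y -> ~~ P y x.
Proof.
move=> [Ptr HP] Pxy; apply/negP => Pyx.
by have := Hirr x; rewrite HP (Ptr _ _ _ Pxy Pyx).
Qed.

(** Induction along the forcing chain, with the apex [a] joined to every edge reached. If (u, v)
    forces (u, w) and [a] is not joined to [w], then (u, w) forces (u, a), which lies in the class
    of (b, a); this is excluded. The other kind of step is dual. *)
Lemma triangle_lemma a b c b' c' : H a b -> H a c -> H b c ->
    ~~ iclass (b, c) (b, a) -> ~~ iclass (b, c) (a, c) ->
  iclass (b, c) (b', c') -> iclass (a, b) (a, b') /\ iclass (a, c) (a, c').
Proof.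
move=> Hab Hac Hbc nba nac bc'.
pose Q u v := [/\ iclass (b, c) (u, v), iclass (a, b) (a, u)
                & iclass (a, c) (a, v)].
suff: Q b' c' by case.
apply: (@iclass_ind Q b c) bc' _; last by split; apply: connect0.
- move=> u v w Huv Huw nH [cuv cu cv].
  have cuw : iclass (b, c) (u, w).
    by apply: iclass_trans cuv _; apply: iclass_forcer.
  suff Haw : H a w.
    split=> //; apply: (iclass_trans cv); apply: iclass_forcer => //.
    exact: (iclass_edge cv).
  apply: contraNT nba => nHaw; apply: iclass_trans cuw _.
  have Hua : H u a by rewrite Hsym (iclass_edge cu).
  apply: (@iclass_trans _ (u, a)).
    by apply: iclass_forcer; rewrite // Hsym.
  by apply: iclass_rev; rewrite iclass_sym.
- move=> u v w Huv Hwv nH [cuv cu cv].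
  have cwv : iclass (b, c) (w, v).
    by apply: iclass_trans cuv _; apply: iclass_forcel.
  suff Haw : H a w.
    split=> //; apply: (iclass_trans cu); apply: iclass_forcer => //.
    exact: (iclass_edge cu).
  apply: contraNT nac => nHaw; apply: iclass_trans cwv _.
  have Hav : H a v by rewrite (iclass_edge cv).
  apply: (@iclass_trans _ (a, v)); last by rewrite iclass_sym.
  by apply: iclass_forcel; rewrite // Hsym.
Qed.

Lemma iclass_asym P x y : transitive_orientation H P ->
  H x y -> ~~ iclass (x, y) (y, x).
Proof.
move=> HP; have asym := orient_asym HP; have [_ PE] := HP.
rewrite PE => /orP[] Pxy; apply/negP => cxy.
  by have := asym _ _ Pxy; rewrite (iclass_orient HP cxy).
by have := asym _ _ Pxy; rewrite (iclass_orient HP (iclass_rev cxy)).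
Qed.

(** Otherwise the triangle lemma with apex [x] applies to (y, z). Moving that edge to (x, y), a
    member of its own class, would put the loop (x, x) in the class. *)
Lemma iclass_transitive P x y z : transitive_orientation H P ->
  H x y -> iclass (x, y) (y, z) -> iclass (x, y) (x, z).
Proof.
move=> HP Hxy cyz; have [Ptr PE] := HP.
have Hyz := iclass_edge cyz Hxy.
have czx : iclass (y, z) (x, y) by rewrite iclass_sym.
have Hxz : H x z.
  move: (Hxy); rewrite !PE => /orP[] Pxy.
    by rewrite (Ptr _ _ _ Pxy (iclass_orient HP cyz Pxy)).
  by rewrite (Ptr _ _ _ (iclass_orient HP (iclass_rev cyz) Pxy) Pxy) orbT.
apply/negPn/negP => ncl.
have [||cxx _] := @triangle_lemma x y z x y Hxy Hxz Hyz _ _ czx.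
- apply/negP => cyx; have /negP := iclass_asym HP Hxy.
  by apply; apply: iclass_trans cyz _.
- by apply: contra ncl => /(iclass_trans cyz).
by have := iclass_edge cxx Hxy; rewrite Hirr.
Qed.

Lemma same_color_sym p q : same_color p q = same_color q p.
Proof.
case: p q => [a b] [c d]; rewrite /same_color /= iclass_sym; congr orb.
by apply/idP/idP => /iclass_rev; rewrite iclass_sym.
Qed.

Lemma same_colorV p c d : same_color p (d, c) = same_color p (c, d).
Proof. by rewrite /same_color orbC. Qed.

Lemma same_colorVl c d p : same_color (d, c) p = same_color (c, d) p.
Proof. by rewrite same_color_sym same_colorV same_color_sym. Qed.

Lemma rainbow_flip x y z : rainbow x y z -> rainbow z y x.
Proof.
move=> [[Hxy Hyz Hxz] n1 n2 n3].
split; first by split; rewrite Hsym.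
- by rewrite same_colorVl same_colorV same_color_sym.
- by rewrite same_colorVl same_colorV.
- by rewrite same_colorVl same_colorV.
Qed.

Lemma rainbow_rot x y z : rainbow x y z -> rainbow y z x.
Proof.
move=> [[Hxy Hyz Hxz] n1 n2 n3].
split; first by split; rewrite // Hsym.
- by rewrite same_colorV.
- by rewrite same_colorVl same_colorV same_color_sym.
- by rewrite same_colorV same_color_sym.
Qed.

Lemma rainbow_iclass x y z b : rainbow x y z ->
  iclass (x, y) (x, b) = iclass (z, y) (z, b).
Proof.
suff imp u v w c : rainbow u v w ->
    iclass (u, v) (u, c) -> iclass (w, v) (w, c).
  by move=> xyz; apply/idP/idP; apply: imp => //; apply: rainbow_flip.
move=> [[Huv Hvw Huw] n1 n2 n3] cc.
have [||||//] := @triangle_lemma w u v u c _ _ Huv _ _ cc.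
- by rewrite Hsym.
- by rewrite Hsym.
- by apply: contra n3; rewrite /same_color => ->.
- by apply: contra n1; rewrite /same_color => ->; rewrite orbT.
Qed.

Lemma rainbow_iclassE x y z b : rainbow x y z ->
  (b \in sources y z) = iclass (x, y) (x, b).
Proof.
move=> xyz; rewrite inE; apply/existsP/idP => [[c cbc]|].
  have [[Hxy Hyz Hxz] n1 n2 n3] := xyz.
  have [||//] := @triangle_lemma x y z b c Hxy Hxz Hyz _ _ cbc.
  - by apply: contra n1; rewrite same_color_sym /same_color orbC => ->.
  - by apply: contra n2; rewrite /same_color => ->.
by rewrite (rainbow_iclass _ xyz) => /iclass_rev; exists z.
Qed.

(** Each corner of a rainbow triangle thus has a single source set, hence a single key, and
    comparing keys cannot orient the triangle cyclically. *)
Lemma rainbow_sources x y z : rainbow x y z -> sources y x = sources y z.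
Proof.
move=> xyz; apply/setP => b; rewrite (rainbow_iclassE _ xyz).
by rewrite (rainbow_iclassE _ (rainbow_flip xyz)) (rainbow_iclass _ xyz).
Qed.

(** First [y] is moved to [b]; then the triangle lemma with apex [b] moves the edge (x, z) to (x,
    c), and so (b, z) to (b, c). *)
Lemma rainbow_complete x y z b c : rainbow x y z ->
  b \in sources y z -> c \in sources z y -> iclass (y, z) (b, c).
Proof.
move=> xyz; rewrite (rainbow_iclassE _ xyz) => cb.
have xzy : rainbow x z y by apply: rainbow_flip; apply: rainbow_rot.
rewrite (rainbow_iclassE _ xzy) => cc.
have cbz : iclass (y, z) (b, z).
  by apply: iclass_rev; rewrite -(rainbow_iclass _ xyz).
apply: (iclass_trans cbz).
have [[Hxy Hyz Hxz] n1 n2 n3] := xyz.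
have Hxb := iclass_edge cb Hxy.
have Hbz := iclass_edge cbz Hyz.
have [|||_ //] := @triangle_lemma b x z x c _ Hbz Hxz _ _ cc.
- by rewrite Hsym.
- apply: contra n3 => cxz; rewrite same_color_sym /same_color.
  by rewrite (iclass_trans cxz) // iclass_sym.
- apply: contra n2 => cxz; rewrite same_color_sym /same_color.
  by rewrite (iclass_trans cxz) // iclass_sym.
Qed.

Lemma sources_iclass x y x' y' :
  iclass (x, y) (x', y') -> sources x y = sources x' y'.
Proof.
move=> cxy; apply/setP => a; rewrite !inE; apply: eq_existsb => b.
by apply/idP/idP; apply: iclass_trans; rewrite // iclass_sym.
Qed.

(** * Meeting all requirements with one transitive orientation *)

Section Literals.
Variables (R : realFieldType) (U D : T -> R) (M : R) (P0 : rel T).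
Hypotheses (M_gt0 : 0 < M) (U_gt : forall x, - M < U x).
Hypothesis (D_lt : forall x, D x < M).
Hypothesis HP0 : transitive_orientation H P0.
Hypothesis lit2 : forall a b c d, U a <= D b -> U c <= D d ->
  exists P : rel T, [/\ transitive_orientation H P, ~~ P b a & ~~ P d c].

Definition forced x y :=
  [exists p : T * T, iclass (x, y) p && (U p.1 <= D p.2)].

(* If S must precede S' and S' need not precede S, then
   min U S <= max D S' and max D S < min U S', so the sum increases strictly.
   The bounds M and -M only serve as neutral elements. *)
Definition key (S : {set T}) :=
  \big[Num.min/M]_(a in S) U a + \big[Num.max/- M]_(a in S) D a.

(** [P0] breaks ties between keys: it is transitive and constant on classes, so [forward] stays
    constant on classes and acyclic on rainbow triangles. *)
Definition forward x y :=
  let kx := key (sources x y) in let ky := key (sources y x) in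
  (kx < ky) || (kx == ky) && P0 x y.

(* [forward] alone may contradict [forced] on classes meeting no rainbow
   triangle. *)
Definition chosen x y := H x y && (forced x y || ~~ forced y x && forward x y).

(** Two opposite requirements in one class would both be met by the orientation from [lit2], which
    orients the class coherently. *)
Lemma forced_asym x y : H x y -> forced x y -> ~~ forced y x.
Proof.
move=> Hxy /existsP[[a b] /andP[cab /= Uab]].
apply/negP => /existsP[[c d] /andP[ccd /= Ucd]].
have [P [HP nba ndc]] := lit2 Uab Ucd.
have asym := orient_asym HP; have [_ PE] := HP.
have := iclass_edge ccd; rewrite Hsym => /(_ Hxy).
rewrite PE (negPf ndc) orbF => Pcd.
have := iclass_edge cab Hxy; rewrite PE (negPf nba) orbF => Pab.
have Pxy : P x y by apply: (iclass_orient HP _ Pab); rewrite iclass_sym.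
have := asym _ _ Pxy.
by rewrite (iclass_orient HP _ Pcd) // iclass_sym.
Qed.

Lemma forced_iclass x y x' y' :
  iclass (x, y) (x', y') -> forced x y = forced x' y'.
Proof.
move=> cxy; apply: eq_existsb => p; congr andb.
by apply/idP/idP; apply: iclass_trans; rewrite // iclass_sym.
Qed.

Lemma forward_iclass x y x' y' :
  iclass (x, y) (x', y') -> forward x y = forward x' y'.
Proof.
move=> cxy; rewrite /forward (sources_iclass cxy).
rewrite (sources_iclass (iclass_rev cxy)); congr (_ || _ && _).
apply/idP/idP; apply: (iclass_orient HP0) => //.
by rewrite iclass_sym.
Qed.

Lemma chosen_iclass x y x' y' :
  iclass (x, y) (x', y') -> chosen x y -> chosen x' y'.
Proof.
move=> cxy; rewrite /chosen (forced_iclass cxy) (forward_iclass cxy).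
rewrite (forced_iclass (iclass_rev cxy)) => /andP[Hxy ->].
by rewrite (iclass_edge cxy).
Qed.

Lemma forward_total x y : H x y -> forward x y || forward y x.
Proof.
rewrite (HP0.2) /forward; case: ltgtP => //=.
Qed.

Lemma forward_asym x y : forward x y -> ~~ forward y x.
Proof.
rewrite /forward; case: ltgtP => //= _; exact: orient_asym.
Qed.

Lemma chosen_total x y : H x y = chosen x y || chosen y x.
Proof.
rewrite /chosen (Hsym y); case Hxy: (H x y) => //=.
have := forward_total Hxy.
by case: (forced x y); case: (forced y x) => //=; case: (forward x y).
Qed.

Lemma chosen_asym x y : chosen x y -> ~~ chosen y x.
Proof.
rewrite /chosen (Hsym y) => /andP[Hxy]; rewrite Hxy /=.
case Fxy: (forced x y) => /=; first by rewrite (negPf (forced_asym Hxy Fxy)).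
by case: (forced y x) => //=; apply: forward_asym.
Qed.

Lemma key_lt (S S' : {set T}) a b : a \in S -> b \in S' -> U a <= D b ->
  {in S' & S, forall x y, D y < U x} -> key S < key S'.
Proof.
move=> aS bS' Uab DU.
have le1 : \big[Num.min/M]_(x in S) U x <= \big[Num.max/- M]_(x in S') D x.
  apply: (@le_trans _ _ (U a)); first exact: bigmin_le_cond.
  by apply: (le_trans Uab); apply: le_bigmax_cond.
have lt2 : \big[Num.max/- M]_(x in S) D x < \big[Num.min/M]_(x in S') U x.
  apply: lt_bigmin => [|x xS'].
    apply: bigmax_lt => [|y _]; [by rewrite -subr_gt0 opprK addr_gt0|exact: D_lt].
  apply: bigmax_lt => [|y yS]; [exact: U_gt|exact: DU].
rewrite /key; lra.
Qed.

(** Since the class is a full product, the absence of a requirement from [z] to [y] bounds every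
    pair of sources, as [key_lt] demands. *)
Lemma rainbow_chosen_forward x y z : rainbow x y z -> chosen y z -> forward y z.
Proof.
move=> xyz /andP[Hyz /orP[Fyz|/andP[]//]].
have := forced_asym Hyz Fyz; rewrite negb_exists => /forallP nF.
case/existsP: Fyz => [[a b] /andP[cab /= Uab]].
apply/orP; left; apply: (@key_lt _ _ a b) => //.
- by rewrite inE; apply/existsP; exists b.
- by rewrite inE; apply/existsP; exists a; apply: iclass_rev.
move=> c d cS dS; have := nF (c, d); rewrite /= negb_and -ltNge => /orP[]//.
by rewrite (iclass_rev (rainbow_complete xyz dS cS)).
Qed.

Lemma rainbow_forward x y z : rainbow x y z ->
  forward x y -> forward y z -> forward x z.
Proof.
move=> xyz; have yzx := rainbow_rot xyz; have zxy := rainbow_rot yzx.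
rewrite /forward (rainbow_sources xyz) (rainbow_sources yzx).
rewrite -(rainbow_sources zxy).
case: ltgtP => //= [lt1|->].
  by case: ltgtP => //= [lt2|<-] _; rewrite ?(lt_trans lt1 lt2) ?lt1.
move=> Pxy; case: ltgtP => //= _.
exact: (HP0.1).
Qed.

(** If x and z were not joined, (x, y) would force (z, y), against asymmetry. A cyclic triangle with
    two edges of one color is excluded by coherence and transitivity of classes; a rainbow one, by
    [forward]. *)
Lemma chosen_trans : transitive chosen.
Proof.
move=> y x z Cxy Cyz.
have [Hxy _] := andP Cxy; have [Hyz _] := andP Cyz.
have Hxz : H x z.
  apply/negPn/negP => nH; have := chosen_asym Cyz.
  by rewrite (chosen_iclass _ Cxy) // iclass_forcel // Hsym.
move: (Hxz); rewrite chosen_total => /orP[//|Czx].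
have [nyx nzy nxz] := And3 (chosen_asym Cxy) (chosen_asym Cyz) (chosen_asym Czx).
have [/orP[] c1|n1] := boolP (same_color (x, y) (y, z)).
- exact: (chosen_iclass (iclass_transitive HP0 Hxy c1)).
- by rewrite (chosen_iclass c1) in nzy.
have [/orP[] c2|n2] := boolP (same_color (y, z) (x, z)).
- exact: (chosen_iclass c2).
- by rewrite (chosen_iclass (iclass_transitive HP0 Hyz c2)) in nyx.
have [/orP[] c3|n3] := boolP (same_color (x, y) (x, z)).
- exact: (chosen_iclass c3).
- rewrite iclass_sym in c3.
  by rewrite (chosen_iclass (iclass_transitive HP0 _ c3)) // Hsym in nzy.
have xyz : rainbow x y z by [].
have yzx := rainbow_rot xyz; have zxy := rainbow_rot yzx.
have Fxz := rainbow_forward xyz (rainbow_chosen_forward zxy Cxy)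
  (rainbow_chosen_forward xyz Cyz).
by have := forward_asym Fxz; rewrite (rainbow_chosen_forward yzx Czx).
Qed.

Lemma forced_orientation :
  exists P, transitive_orientation H P /\ forall x y, P x y -> D x < U y.
Proof.
exists chosen; split; first by split; [exact: chosen_trans|exact: chosen_total].
move=> x y Cxy; rewrite ltNge; apply: contraTN (Cxy) => UD.
have Fyx : forced y x.
  apply/existsP; exists (y, x).
  by rewrite UD andbT; apply: connect0.
have [Hxy _] := andP Cxy.
by rewrite /chosen Fyx orbF negb_and orbC forced_asym // Hsym.
Qed.

End Literals.
End ImplicationClasses.

(** * Realizing an orientation by eliminating endpoints *)

Lemma separate (R : realFieldType) (s t : seq R) :
  {in s & t, forall a b, a < b} ->
  exists c, {in s, forall a, a < c} /\ {in t, forall b, c < b}.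
Proof.
have sep1 a (u : seq R) : {in u, forall b, a < b} ->
    exists c, a < c /\ {in u, forall b, c < b}.
  elim: u => [|e u IHu] lt_a; first by exists (a + 1); split=> //; lra.
  have [|c [ac cu]] := IHu; first by move=> b bu; rewrite lt_a // inE bu orbT.
  have ae : a < e by rewrite lt_a ?mem_head.
  exists (Num.min c ((a + e) / 2)); split; first by rewrite lt_min ac; lra.
  move=> b; rewrite inE gt_min => /orP[/eqP->|/cu->//].
  by apply/orP; right; lra.
elim: s => [_|a s IHs st].
  elim: t => [|b t [c [_ ct]]]; first by exists 0.
  exists (Num.min c (b - 1)); split=> // x.
  rewrite inE gt_min => /orP[/eqP->|/ct->//].
  by apply/orP; right; lra.
have [|c [sc ct]] := IHs.
  by move=> x y xs yt; rewrite st // inE xs orbT.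
have [|e [ae et]] := sep1 a t; first by move=> y yt; rewrite st ?mem_head.
exists (Num.max c e); split=> x; last by move=> xt; rewrite gt_max ct ?et.
rewrite inE lt_max => /orP[/eqP->|/sc->//].
by rewrite ae orbT.
Qed.

(** For strict orders this excludes 2+2, the characterization of interval orders. *)
Definition ferrers (T : finType) (P : rel T) :=
  forall a b c d, P a b -> P c d -> P a d || P c b.

(** A violation in [P] yields two edges ab and cd of [H] with no other edge among their ends. This
    depends on [H] alone, so [P0] would violate the condition too. *)
Lemma ferrers_orientation (T : finType) (H P P0 : rel T) :
    transitive_orientation H P0 -> transitive_orientation H P ->
  ferrers P0 -> ferrers P.
Proof.
move=> [tr0 E0] [tr E] F0 a b c d Pab Pcd; apply/negPn/negP.
rewrite negb_or => /andP[nad ncb].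
have nHad : ~~ H a d.
  rewrite E (negPf nad); apply: contra ncb => Pda.
  exact: tr Pcd (tr _ _ _ Pda Pab).
have nHcb : ~~ H c b.
  rewrite E (negPf ncb); apply: contra nad => Pbc.
  exact: tr Pab (tr _ _ _ Pbc Pcd).
have nHbd : ~~ H b d.
  by rewrite E; apply/norP; split; [apply: contra nad|apply: contra ncb]; apply: tr.
have nHac : ~~ H a c.
  rewrite E; apply/norP; split; [apply: contra nad|apply: contra ncb] => H1.
    exact: tr H1 Pcd.
  exact: tr H1 Pab.
have Hab : P0 a b || P0 b a by rewrite -E0 E Pab.
have Hcd : P0 c d || P0 d c by rewrite -E0 E Pcd.
move: nHad nHcb nHbd nHac; rewrite !E0 !negb_or.
move=> /andP[/negPf n1 /negPf n2] /andP[/negPf n3 /negPf n4].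
move=> /andP[/negPf n5 /negPf n6] /andP[/negPf n7 /negPf n8].
case/orP: Hab => H1; case/orP: Hcd => H2; have := F0 _ _ _ _ H1 H2.
- by rewrite n1 n3.
- by rewrite n7 n6.
- by rewrite n5 n8.
- by rewrite n4 n2.
Qed.

Section Realization.
Variables (T : finType) (R : realFieldType) (H P : rel T).
Hypotheses (Hsym : symmetric H) (Hirr : irreflexive H).
Hypotheses (HP : transitive_orientation H P) (Pferrers : ferrers P).

(* For x in N[z]: a lower bound on the right endpoint of z, read off x;
   [upper] bounds the left endpoint of w from above. *)
Definition lower (l r : T -> R) x z := if x == z then r x else l x.
Definition upper (l r : T -> R) y w := if y == w then l y else r y.

(** Here [z] and [w] range over all vertices, drawn or not: the second condition is what is left of
    [r z < l w] once undrawn endpoints are eliminated. *)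
Definition compatible (W : {set T}) (l r : T -> R) :=
  {in W &, forall x y, ~~ H x y -> l x <= r y} /\
  forall z w x y, P z w -> x \in W -> y \in W -> ~~ H x z -> ~~ H y w ->
    lower l r x z < upper l r y w.

Lemma ferrersN a b c d : P a b -> P c d -> ~~ H c b -> P a d.
Proof.
move=> Pab Pcd; rewrite (HP.2) negb_or => /andP[/negPf nP _].
by have := Pferrers Pab Pcd; rewrite nP orbF.
Qed.

Lemma compatible_add (W : {set T}) (l r : T -> R) v :
    v \notin W -> compatible W l r ->
  exists l' r',
    [/\ compatible (v |: W) l' r', {in W, l' =1 l} & {in W, r' =1 r}].
Proof.
move=> vW [adjW sepW].
have PH z w : P z w -> H z w by rewrite (HP.2) => ->.
(* The left endpoint [lv] must exceed the bounds on right endpoints of all [z] left of [v]. It must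
   stay below the bounds on left endpoints of [v] itself and of each [w] right of some [z] that
   meets [v]. *)
pose lo := [seq lower l r p.1 p.2 | p <- enum [pred p : T * T |
  [&& p.1 \in W, ~~ H p.1 p.2 & P p.2 v]]].
pose up := [seq upper l r p.1 p.2 | p <- enum [pred p : T * T |
  [&& p.1 \in W, ~~ H p.1 p.2 &
    (p.2 == v) || [exists z, ~~ H z v && P z p.2]]]].
have lo_up : {in lo & up, forall a b, a < b}.
  move=> _ _ /mapP[[x z] + ->] /mapP[[y w] + ->].
  rewrite !mem_enum !inE /= => /and3P[xW nxz Pzv] /and3P[yW nyw].
  case/orP => [/eqP wv|/existsP[z' /andP[nz' Pz'w]]].
    by apply: sepW; rewrite // wv.
  (* As [z'] equals [v] or meets it, the Ferrers condition puts [z] left of [w]. *)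
  by apply: sepW => //; apply: ferrersN Pzv Pz'w nz'.
have [lv [lo_lv lv_up]] := separate lo_up.
(* The dual bounds for the right endpoint. Adding [lv] to [lo2] keeps the interval nonempty; [lv] is
   below [up2] because [up] contains those bounds, with [v] as the intermediate vertex. *)
pose lo2 := [seq lower l r p.1 p.2 | p <- enum [pred p : T * T |
  [&& p.1 \in W, ~~ H p.1 p.2 &
    (p.2 == v) || [exists w, ~~ H w v && P p.2 w]]]].
pose up2 := [seq upper l r p.1 p.2 | p <- enum [pred p : T * T |
  [&& p.1 \in W, ~~ H p.1 p.2 & P v p.2]]].
have lo_up2 : {in lv :: lo2 & up2, forall a b, a < b}.
  move=> a _ + /mapP[[y w] + ->].
  rewrite mem_enum !inE /= => + /and3P[yW nyw Pvw].
  case/orP => [/eqP->|/mapP[[x z] + ->]].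
    apply: lv_up; apply/mapP; exists (y, w) => //.
    rewrite mem_enum !inE /= yW nyw; apply/orP; right; apply/existsP; exists v.
    by rewrite Hirr.
  rewrite mem_enum !inE /= => /and3P[xW nxz].
  case/orP => [/eqP zv|/existsP[w' /andP[nw' Pzw']]].
    by apply: sepW; rewrite // zv.
  apply: sepW => //; apply: ferrersN Pzw' Pvw _.
  by rewrite Hsym.
have [rv [lo_rv rv_up]] := separate lo_up2.
pose l' x := if x == v then lv else l x.
pose r' x := if x == v then rv else r x.
have lt_lrv : lv < rv by rewrite lo_rv ?mem_head.
have l'W : {in W, l' =1 l}.
  by move=> x xW; rewrite /l'; case: eqP => // xv; rewrite xv (negPf vW) in xW.
have r'W : {in W, r' =1 r}.
  by move=> x xW; rewrite /r'; case: eqP => // xv; rewrite xv (negPf vW) in xW.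
have l'v : l' v = lv by rewrite /l' eqxx.
have r'v : r' v = rv by rewrite /r' eqxx.
have lowW x z : x \in W -> lower l' r' x z = lower l r x z.
  by move=> xW; rewrite /lower l'W ?r'W.
have upW x z : x \in W -> upper l' r' x z = upper l r x z.
  by move=> xW; rewrite /upper l'W ?r'W.
have neqW x : x \in W -> (x == v) = false.
  by move=> xW; apply/eqP => xv; rewrite xv (negPf vW) in xW.
exists l', r'; split=> //; split.
  move=> x y; rewrite !inE => /orP[/eqP->|xW] /orP[/eqP->|yW] nxy.
  - by rewrite l'v r'v ltW.
  - rewrite l'v r'W // ltW //; apply: lv_up; apply/mapP; exists (y, v).
      by rewrite mem_enum !inE /= yW eqxx andbT Hsym.
    by rewrite /upper /= neqW.
  - rewrite r'v l'W // ltW //; apply: lo_rv; rewrite inE; apply/orP; right.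
    apply/mapP; exists (x, v); first by rewrite mem_enum !inE /= xW eqxx andbT.
    by rewrite /lower /= neqW.
  - by rewrite l'W // r'W // adjW.
move=> z w x y Pzw; rewrite !inE => /orP[/eqP->|xW] /orP[/eqP->|yW] nxz nyw.
- rewrite /lower /upper l'v r'v; case: eqP => [vz|_].
    by move: nyw; rewrite vz PH.
  by case: eqP => [vw|//]; move: nxz; rewrite vw Hsym PH.
- rewrite upW // /lower l'v r'v; case: eqP => [vz|_].
    apply: rv_up; apply/mapP; exists (y, w) => //.
    by rewrite mem_enum !inE /= yW nyw vz.
  apply: lv_up; apply/mapP; exists (y, w) => //.
  rewrite mem_enum !inE /= yW nyw; apply/orP; right; apply/existsP; exists z.
  by rewrite Hsym nxz.
- rewrite lowW // /upper l'v r'v; case: eqP => [vw|_].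
    apply: lo_lv; apply/mapP; exists (x, z) => //.
    by rewrite mem_enum !inE /= xW nxz vw.
  apply: lo_rv; rewrite inE; apply/orP; right; apply/mapP; exists (x, z) => //.
  rewrite mem_enum !inE /= xW nxz; apply/orP; right; apply/existsP; exists w.
  by rewrite Hsym nyw.
- by rewrite lowW // upW // sepW.
Qed.

Lemma compatible_realization (W : {set T}) (l r : T -> R) :
    compatible W l r ->
  exists l' r', [/\ {in W, l' =1 l}, {in W, r' =1 r},
    forall x y, ~~ H x y -> l' x <= r' y & forall x y, P x y -> r' x < l' y].
Proof.
have [n] := ubnP #|~: W|; elim: n W l r => // n IHn W l r ltWn cW.
have [W0|[v]] := set_0Vmem (~: W).
  have inW x : x \in W by move/setP/(_ x): W0; rewrite !inE => /negbFE.
  have [adjW sepW] := cW; exists l, r; split=> // [x y|x y Pxy].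
    exact: adjW.
  (* With every vertex drawn, [x] and [y] serve as their own witnesses. *)
  by have := sepW x y x y; rewrite /lower /upper !eqxx !Hirr => ->.
rewrite inE => vW; have [l1 [r1 [c1 l1W r1W]]] := compatible_add vW cW.
have [|l2 [r2 [l2W r2W adj2 sep2]]] := IHn _ _ _ _ c1.
  rewrite -ltnS; apply: leq_trans ltWn; rewrite ltnS; apply: proper_card.
  rewrite finset.properC properE finset.subsetUr; apply/negP => /fintype.subsetP/(_ v).
  by rewrite !inE eqxx (negPf vW) => /(_ isT).
exists l2, r2; split=> // x xW; first by rewrite l2W ?l1W // inE xW orbT.
by rewrite r2W ?r1W // inE xW orbT.
Qed.

End Realization.

(** * From interval representations to orientations of the complement and back *)

Definition nonadj (G : sgraph) : rel G := fun x y => (x != y) && ~~ adj x y.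

Lemma nonadj_sym (G : sgraph) : symmetric (@nonadj G).
Proof. by move=> x y; rewrite /nonadj eq_sym adj_sym. Qed.

Lemma nonadj_irrefl (G : sgraph) : irreflexive (@nonadj G).
Proof. by move=> x; rewrite /nonadj eqxx. Qed.

Lemma itvcc_meet (R : realType) (a b c d : R) : a <= b -> c <= d ->
  (`[a, b] `&` `[c, d] !=set0)%classic <-> (a <= d) && (c <= b).
Proof.
move=> ab cd; split.
  move=> [x []] /=; rewrite !in_itv /= => /andP[ax xb] /andP[cx xd].
  by rewrite (le_trans ax xd) (le_trans cx xb).
move=> /andP[ad cb]; exists (Num.max a c); split=> /=.
  by rewrite in_itv /= le_max lexx ge_max ab cb.
by rewrite in_itv /= le_max lexx orbT ge_max ad cd.
Qed.

Lemma itvcc_inj (R : realType) (a b c d : R) : a <= b -> c <= d ->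
  `[a, b]%classic = `[c, d]%classic -> a = c /\ b = d.
Proof.
move=> ab cd E.
have sub x : (a <= x <= b) = (c <= x <= d).
  have Ex : `[a, b]%classic x = `[c, d]%classic x by rewrite E.
  by rewrite /= !in_itv /= in Ex; apply/idP/idP; rewrite Ex.
have := sub a; have := sub b; have := sub c; have := sub d.
rewrite !lexx ab cd !andbT /= => /andP[ad db] /andP[ac cb].
move=> /esym/andP[cb' bd] /esym/andP[ca ad'].
by split; apply: le_anti; apply/andP.
Qed.

Lemma interval_repE (R : realType) (G : sgraph) (J : G -> set R) (l r : G -> R) :
    (forall x, l x <= r x) -> (forall x, J x = `[l x, r x]%classic) ->
  interval_rep J <-> forall x y, nonadj x y = (r x < l y) || (r y < l x).
Proof.
move=> lr JE.
have meet x y : (J x `&` J y !=set0)%classic <->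
    ~~ ((r x < l y) || (r y < l x)).
  by rewrite !JE negb_or -!leNgt andbC; apply: itvcc_meet.
split=> [[_ adjJ] x y|H].
  rewrite /nonadj; have [->|/eqP xy] := eqVneq x y.
    by rewrite /= orbb ltNge lr.
  apply/negP/idP => [nadj|lt_xy nadj].
    by apply: contraT => /meet/(adjJ _ _ xy).
  by move/(adjJ _ _ xy)/meet: nadj; rewrite lt_xy.
split=> [x|x y /eqP xy]; first by exists (l x), (r x).
apply: (iff_trans (meet x y)).
by rewrite -H /nonadj xy /= negbK.
Qed.

(** The extension orders vertices by [rJ x < lJ y]. Its own endpoints lie between the bounds:
    [lower] is at most [rJ z], and [upper] at least [lJ w]. *)
Lemma extendible_compatible (R : realType) (G : sgraph) (A : {set G})
    (I : G -> set R) (l r : G -> R) :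
    {in A, forall x, l x <= r x /\ I x = `[l x, r x]%classic} ->
    extendible A I ->
  exists P : rel G, [/\ transitive_orientation (@nonadj G) P, ferrers P
                      & compatible (@nonadj G) P A l r].
Proof.
move=> IE [J [repJ JI]].
have /boolp.choice[p pJ] x : exists q : R * R,
    q.1 <= q.2 /\ J x = `[q.1, q.2]%classic.
  by have [a [b ab]] := repJ.1 x; exists (a, b).
pose lJ x := (p x).1; pose rJ x := (p x).2.
have lrJ x : lJ x <= rJ x := (pJ x).1.
have JE x : J x = `[lJ x, rJ x]%classic := (pJ x).2.
have HE := (interval_repE lrJ JE).1 repJ.
have lrA x : x \in A -> l x = lJ x /\ r x = rJ x.
  move=> xA; have [lr Ix] := IE x xA.
  by apply: itvcc_inj; rewrite // -Ix -JE JI.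
have adjJ x y : ~~ nonadj x y -> lJ x <= rJ y.
  by rewrite HE negb_or -!leNgt => /andP[].
exists (fun x y => rJ x < lJ y); split.
- split=> // y x z xy yz.
  exact: lt_trans xy (le_lt_trans (lrJ y) yz).
- move=> a b c d ab cd; have [//|/= da] := ltP (rJ a) (lJ d).
  exact: lt_trans cd (le_lt_trans da ab).
split=> [x y xA yA nxy|z w x y zw xA yA nxz nyw].
  by rewrite (lrA x xA).1 (lrA y yA).2 adjJ.
apply: (@le_lt_trans _ _ (rJ z)).
  rewrite /lower; case: eqP => [<-|_]; first by rewrite (lrA x xA).2.
  by rewrite (lrA x xA).1 adjJ.
apply: (lt_le_trans zw); rewrite /upper; case: eqP => [<-|_].
  by rewrite (lrA y yA).1.
by rewrite (lrA y yA).2 adjJ // nonadj_sym.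
Qed.

Lemma compatible_extendible (R : realType) (G : sgraph) (W : {set G})
    (I : G -> set R) (l r : G -> R) (P : rel G) :
    {in W, forall x, l x <= r x /\ I x = `[l x, r x]%classic} ->
    transitive_orientation (@nonadj G) P -> ferrers P ->
    compatible (@nonadj G) P W l r ->
  extendible W I.
Proof.
move=> IE HP Pf cW.
have [l' [r' [l'W r'W adj' sep']]] :=
  compatible_realization (@nonadj_sym G) (@nonadj_irrefl G) HP Pf cW.
exists (fun x => `[l' x, r' x]%classic); split.
  have lr' x : l' x <= r' x by apply: adj'; rewrite nonadj_irrefl.
  apply/(interval_repE lr') => // x y.
  apply/idP/idP; last first.
    by apply: contraTT => nxy; rewrite negb_or -!leNgt !adj' // nonadj_sym.
  by rewrite (HP.2) => /orP[] /sep' ->; rewrite ?orbT.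
by move=> x xW; rewrite l'W // r'W // (IE x xW).2.
Qed.

Theorem corollary1p2 (R : realType) (G : sgraph) (W : {set G})
    (I : G -> set R) (hI : partial_rep W I) :
  extendible W I <->
  (forall A : {set G}, A \subset W -> (#|A| <= 4)%N -> extendible A I).
Proof.
split=> [[J [repJ JI]] A /fintype.subsetP AW _|ext4].
  by exists J; split=> // x /AW/JI.
have /boolp.choice[p pI] x : exists q : R * R, x \in W ->
    q.1 <= q.2 /\ I x = `[q.1, q.2]%classic.
  have [xW|_] := boolP (x \in W); last by exists (0, 0).
  by have [a [b ab]] := hI.1 (exist _ x xW); exists (a, b).
pose l x := (p x).1; pose r x := (p x).2.
have IW : {in W, forall x, l x <= r x /\ I x = `[l x, r x]%classic}.
  by move=> x; apply: pI.
pose H := @nonadj G.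
have ext (s : seq G) : (size s <= 4)%N -> {subset s <= W} ->
    exists P : rel G, [/\ transitive_orientation H P, ferrers P
                        & compatible H P [set v in s] l r].
  move=> s4 sW; apply: (@extendible_compatible _ _ _ I).
    by move=> x; rewrite inE => /sW/IW.
  apply: ext4; first by apply/fintype.subsetP => x; rewrite inE => /sW.
  by rewrite cardsE (leq_trans (card_size s)).
(* The empty set already gives an orientation for ties and the Ferrers property. *)
have [||P0 [HP0 P0f _]] := ext [::] => //.
(* [M] exceeds all endpoints in absolute value, so [M] and [- M] are safe values for an empty
   minimum and maximum; the entry 0 makes [M] positive. *)
have [M [Mbig _]] : exists M : R,
    {in 0 :: codom l ++ codom r ++ codom (fun x => - l x) ++ codom (fun x => - r x),
      forall a, a < M} /\ {in [::] : seq R, forall b, M < b}.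
  by apply: separate.
have M0 : 0 < M by rewrite Mbig ?mem_head.
have NM : - M < M by rewrite gtrN.
have lM x : - M < l x < M.
  by rewrite ltrNl !Mbig // inE !mem_cat codom_f ?orbT //
    (codom_f (fun x => - l x)) ?orbT.
have rM x : - M < r x < M.
  by rewrite ltrNl !Mbig // inE !mem_cat codom_f ?orbT //
    (codom_f (fun x => - r x)) ?orbT.
pose U w := \big[Num.min/M]_(y in W | ~~ H y w) upper l r y w.
pose D z := \big[Num.max/- M]_(x in W | ~~ H x z) lower l r x z.
have U_gt w : - M < U w.
  apply: lt_bigmin => // y _; rewrite /upper.
  by case: ifP => _; [have /andP[] := lM y|have /andP[] := rM y].
have D_lt z : D z < M.
  apply: bigmax_lt => // x _; rewrite /lower.
  by case: ifP => _; [have /andP[] := rM x|have /andP[] := lM x].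
(* The default values never create a requirement, so real bounds witness it. *)
have witness a b : U a <= D b -> exists x y,
    [/\ x \in W, y \in W, ~~ H x b, ~~ H y a & upper l r y a <= lower l r x b].
  move=> UD; have /existsP[[x y]] : [exists q : G * G,
      [&& q.1 \in W, q.2 \in W, ~~ H q.1 b, ~~ H q.2 a
        & upper l r q.2 a <= lower l r q.1 b]].
    apply: contraTT UD; rewrite negb_exists -ltNge => /forallP noq.
    apply: lt_bigmin => [|y /andP[yW nya]]; first exact: D_lt.
    apply: bigmax_lt => [|x /andP[xW nxb]].
      by rewrite /upper; case: ifP => _; [have /andP[] := lM y|have /andP[] := rM y].
    by have := noq (x, y); rewrite /= xW yW nxb nya /= -ltNge.
  by move=> /and5P[]; exists x, y.
have lit2 a b c d : U a <= D b -> U c <= D d ->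
    exists P : rel G, [/\ transitive_orientation H P, ~~ P b a & ~~ P d c].
  move=> /witness[x [y [xW yW nx ny le1]]] /witness[x' [y' [x'W y'W nx' ny' le2]]].
  (* The source of the constant 4: two requirements, two predrawn witnesses each. *)
  have [|v|P [HP _ [_ sep]]] := ext [:: x; y; x'; y'] => //.
    by rewrite !inE => /or4P[] /eqP->.
  exists P; split=> //.
    apply: contraTN le1 => Pba; rewrite -ltNge.
    by apply: sep; rewrite // !inE eqxx ?orbT.
  apply: contraTN le2 => Pdc; rewrite -ltNge.
  by apply: sep; rewrite // !inE eqxx ?orbT.
have [P [HP DU]] := forced_orientation (@nonadj_sym G) (@nonadj_irrefl G)
  M0 U_gt D_lt HP0 lit2.
apply: (compatible_extendible IW HP (ferrers_orientation HP0 HP P0f)).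
split=> [x y xW yW nxy|z w x y Pzw xW yW nxz nyw].
  have [|v|P' [_ _ [adjP' _]]] := ext [:: x; y] => //.
    by rewrite !inE => /orP[] /eqP->.
  by apply: adjP'; rewrite // !inE eqxx ?orbT.
apply: (@le_lt_trans _ _ (D z)).
  by apply: (le_bigmax_cond _ (lower l r ^~ z)); rewrite xW.
apply: (lt_le_trans (DU _ _ Pzw)).
by apply: (bigmin_le_cond _ (upper l r ^~ w)); rewrite yW.
Qed.
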